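(* Let $T=\{2134,2341,2413\}$. Then $$F_T(x)=\frac{1-6x+10x^2-3x^3+x^4}{(1-3x+x^2)(1-4x+2x^2)}.$$
   Context: $S_n(T)$ denotes the set of permutations $\pi$ of $[n]=\{1,\dots,n\}$ (one-line notation) that avoid every pattern $\tau\in T$, i.e. no subsequence of $\pi$ is order-isomorphic to $\tau$. $F_T(x)=\sum_{n\ge 0}|S_n(T)|x^n$, a formal power series, with $|S_0(T)|=1$. *)

(* Defs.v *)
From mathcomp Require Import all_boot all_order all_fingroup all_algebra.

Set Implicit Arguments.
Unset Strict Implicit.
Unset Printing Implicit Defensive.

Import GRing.Theory.

(* ['S_n] acts on ['I_n = {0, .., n-1}]; values are shifted by one so that the
   word is the one-line notation over [{1, .., n}]. *)
Definition one_line (n : nat) (pi : 'S_n) : seq nat :=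
  [seq (pi i).+1 | i <- enum 'I_n].

Definition order_isomorphic (s t : seq nat) : bool :=
  (size s == size t) &&
  [forall i : 'I_(size s), forall j : 'I_(size s),
     (nth 0 s i < nth 0 s j) == (nth 0 t i < nth 0 t j)].

(* The subsequences of [w] are the words [mask m w] (see [subseqP]). *)
Definition avoids (tau w : seq nat) : bool :=
  [forall m : (size w).-tuple bool, ~~ order_isomorphic (mask m w) tau].

Definition avoiders (T : seq (seq nat)) (n : nat) : {set 'S_n} :=
  [set pi : 'S_n | all (fun tau => avoids tau (one_line pi)) T].

Local Open Scope ring_scope.

(* A formal power series is its sequence of coefficients. *)
Definition fps (R : Type) : Type := nat -> R.

Definition fps_of_poly (R : nzRingType) (p : {poly R}) : fps R := fun n => p`_n.

Definition fps_mul (R : nzRingType) (f g : fps R) : fps R :=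
  fun n => \sum_(i < n.+1) f i * g (n - i)%N.

(* [fps_inv_coefs q n] is [:: v_n; ...; v_1; v_0], where
   v_0 = 1/q_0 and v_(n+1) = - (1/q_0) * \sum_(1 <= j <= n+1) q_j * v_(n+1-j). *)
Fixpoint fps_inv_coefs (R : fieldType) (q : fps R) (n : nat) : seq R :=
  if n is m.+1 then
    let v := fps_inv_coefs q m in
    (- (q 0%N)^-1 * \sum_(i < m.+1) q i.+1 * v`_i) :: v
  else [:: (q 0%N)^-1].

(* The multiplicative inverse when [q 0 != 0] (see [fps_mulfV]); a junk value
   otherwise. *)
Definition fps_inv (R : fieldType) (q : fps R) : fps R :=
  fun n => head 0 (fps_inv_coefs q n).

Definition fps_div (R : fieldType) (p q : fps R) : fps R :=
  fps_mul p (fps_inv q).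

Lemma nth_fps_inv_coefs (R : fieldType) (q : fps R) (n i : nat) :
  (i <= n)%N -> (fps_inv_coefs q n)`_i = fps_inv q (n - i)%N.
Proof.
elim: n i => [|n IHn] [|i] //=.
by move=> le_in; rewrite IHn.
Qed.

Lemma fps_mulfV (R : fieldType) (q : fps R) : q 0%N != 0 ->
  fps_mul q (fps_inv q) =1 fps_of_poly 1.
Proof.
move=> q0 n; rewrite /fps_mul /fps_of_poly coef1 big_ord_recl subn0.
case: n => [|n]; first by rewrite big_ord0 addr0 /fps_inv /= divff.
rewrite {1}/fps_inv /= mulNr mulrN mulrA divff // mul1r.
rewrite addrC; apply/eqP; rewrite subr_eq0; apply/eqP.
apply: eq_bigr => i _.
by rewrite nth_fps_inv_coefs ?subSS // -ltnS.
Qed.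

(* F_T(x), with rational coefficients so that division is available. *)
Definition avoiders_gf (T : seq (seq nat)) : fps rat :=
  fun n => #|avoiders T n|%:R.

(* Main.v *)
Require Import Defs.
From mathcomp Require Import all_boot all_order all_fingroup all_algebra.
From mathcomp Require Import zify ring lra.

Set Implicit Arguments.
Unset Strict Implicit.
Unset Printing Implicit Defensive.

Import GRing.Theory.

(* Words are 0-based: permutations of 0, ..., n-1.  All three patterns start
   with their second smallest letter, so classify an avoider of length n + 1 by
   its first letter v.  If v is 0 or n, the rest is any avoider of length n.
   Otherwise call a letter large if it exceeds v and small if it is below v:
   each small letter forces the large letters before and after it to be
   decreasing, and those before to be below those after.  Hence
   - either the large letters form a contiguous decreasing block; contracting
     it to one letter gives any avoider of length v + 1;
   - or the small letters form a contiguous word S that splits the large ones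
     into two nonempty decreasing words, the first below the second; here S is
     any avoider of length v that also avoids 213.
   With a_n and b_n the numbers of avoiders of length n, respectively of those
   that avoid 213 too, this gives
     a_(n+2) = 2 a_(n+1) + sum_(0 < v <= n) (a_(v+1) + (n - v) b_v),
     b_(n+1) = b_n + sum_(0 < v <= n) b_v,
   whence b_(n+2) = 3 b_(n+1) - b_n and
     a_(n+3) = 4 a_(n+2) - 2 a_(n+1) + b_(n+1) - b_n. *)

(** * Pattern containment as a finite case analysis *)

Lemma avoidsP (tau w : seq nat) :
  reflect (forall t, subseq t w -> ~~ order_isomorphic t tau) (avoids tau w).
Proof.
apply: (iffP forallP) => [avw t /subseqP[m /eqP size_m ->] | avw m].
  exact: avw (Tuple size_m).
exact/avw/mask_subseq.
Qed.

(** With [iota] in place of ordinals, the test simplifies to explicit inequalities once both words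
    have a known length. *)
Lemma order_isomorphicE (s t : seq nat) :
  order_isomorphic s t =
  (size s == size t) &&
  all (fun i => all (fun j =>
     (nth 0 s i < nth 0 s j) == (nth 0 t i < nth 0 t j)) (iota 0 (size s)))
     (iota 0 (size s)).
Proof.
rewrite /order_isomorphic; congr (_ && _); apply/forallP/allP => [H i | H i].
  rewrite mem_iota => lt_i; apply/allP => j; rewrite mem_iota => lt_j.
  exact: (forallP (H (Ordinal lt_i)) (Ordinal lt_j)).
apply/forallP => j; apply: (allP (H i _)); by rewrite mem_iota /=.
Qed.

(** For an explicit word [t] the right-hand side computes to a disjunction over the cut points of
    [t], ready for case analysis on where each letter falls. *)
Lemma subseq_catE (t s1 s2 : seq nat) :
  subseq t (s1 ++ s2) =
  has (fun i => subseq (take i t) s1 && subseq (drop i t) s2)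
    (iota 0 (size t).+1).
Proof.
apply/idP/hasP => [/subseqP[m size_m ->] | [i _ /andP[ss1 ss2]]]; last first.
  by rewrite -(cat_take_drop i t) cat_subseq.
set m1 := take (size s1) m; set m2 := drop (size s1) m.
have size_m1 : size m1 = size s1.
  by rewrite size_takel // size_m size_cat leq_addr.
have -> : mask m (s1 ++ s2) = mask m1 s1 ++ mask m2 s2.
  by rewrite -mask_cat ?cat_take_drop.
exists (size (mask m1 s1)).
  by rewrite mem_iota add0n ltnS size_cat leq_addr.
by rewrite take_size_cat // drop_size_cat // !mask_subseq.
Qed.

Ltac split_bools :=
  repeat match goal with
  | H : is_true (_ || _) |- _ => case/orP: H => H
  | H : is_true (_ && _) |- _ =>
      let H' := fresh H in case/andP: H => H H'
  end.

(* Hypotheses that are not comparisons are cleared because [lia] becomes very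
   slow on them. *)
Ltac bool_lia := simpl in *; repeat match goal with
  | H : ?P |- _ => lazymatch P with
                   | nat => fail
                   | is_true (leq _ _) => fail
                   | is_true (_ && _) => fail
                   | is_true (negb (andb _ _)) => fail
                   | is_true false => fail
                   | _ => clear H end
  end; lia.

(** * The patterns as inequalities between letters *)

Definition T := [:: [:: 2; 1; 3; 4]; [:: 2; 3; 4; 1]; [:: 2; 4; 1; 3]].
Definition avT (w : seq nat) := all (fun tau => avoids tau w) T.
(** The disjuncts read [a b c d] as 2134, 2341 and 2413, in this order. *)
Definition bad (a b c d : nat) :=
  [|| (b < a) && (a < c) && (c < d), (d < a) && (a < b) && (b < c)
    | (c < a) && (a < d) && (d < b)].

Lemma avTP w :
  reflect (forall a b c d, subseq [:: a; b; c; d] w -> ~~ bad a b c d) (avT w).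
Proof.
have oi t : has (order_isomorphic t) T =
    if t is [:: a; b; c; d] then bad a b c d else false.
  rewrite /= !order_isomorphicE.
  case: t => [|a [|b [|c [|d [|e t]]]]] //=.
  rewrite /bad; lia.
apply: (iffP allP) => [avw a b c d sw | avw tau Ttau].
  rewrite -(oi [:: a; b; c; d]); apply/hasPn => tau Ttau.
  exact: (avoidsP _ _ (avw _ Ttau)).
apply/avoidsP => t sw; apply/negP => tau_t.
have: has (order_isomorphic t) T by apply/hasP; exists tau.
rewrite oi; case: t sw {tau_t} => [|a [|b [|c [|d [|e t]]]]] // /avw.
by move/negP.
Qed.

Lemma av213P w :
  reflect (forall a b c, subseq [:: a; b; c] w -> ~~ ((b < a) && (a < c)))
    (avoids [:: 2; 1; 3] w).
Proof.
have oi t : order_isomorphic t [:: 2; 1; 3] =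
    if t is [:: a; b; c] then (b < a) && (a < c) else false.
  rewrite order_isomorphicE; case: t => [|a [|b [|c [|d t]]]] //=; lia.
apply: (iffP (avoidsP _ _)) => [avw a b c /avw | avw t].
  by rewrite oi.
by rewrite oi; case: t => [|a [|b [|c [|d t]]]] // /avw.
Qed.

Lemma avoids_map f tau w : {mono f : x y / x < y} ->
  avoids tau (map f w) = avoids tau w.
Proof.
move=> f_mono.
have oi t : order_isomorphic (map f t) tau = order_isomorphic t tau.
  rewrite !order_isomorphicE size_map; congr (_ && _).
  apply: eq_in_all => i; rewrite mem_iota => lt_i.
  apply: eq_in_all => j; rewrite mem_iota => lt_j.
  by rewrite !(nth_map 0) // f_mono.
apply/avoidsP/avoidsP => avw t /subseqP[m size_m ->].
  by rewrite -oi avw // map_mask mask_subseq.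
by rewrite -map_mask oi avw // mask_subseq.
Qed.

Lemma avT_cons v p :
  reflect (avT p /\ forall b c d, subseq [:: b; c; d] p -> ~~ bad v b c d)
    (avT (v :: p)).
Proof.
apply: (iffP (avTP _)) => [av | [avp avv] a b c d].
  split=> [|b c d sp]; last by apply: av; rewrite /= eqxx.
  apply/avTP => a b c d sp; apply: av; apply: subseq_trans sp _.
  exact: subseq_cons.
rewrite /=; case: eqP => [-> /avv // | _].
exact: (avTP _ avp).
Qed.

Lemma av213_cons v p :
  reflect (avoids [:: 2; 1; 3] p /\
      forall b c, subseq [:: b; c] p -> ~~ ((b < v) && (v < c)))
    (avoids [:: 2; 1; 3] (v :: p)).
Proof.
apply: (iffP (av213P _)) => [av | [avp avv] a b c].
  split=> [|b c sp]; last by apply: av; rewrite /= eqxx.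
  apply/av213P => a b c sp; apply: av; apply: subseq_trans sp _.
  exact: subseq_cons.
rewrite /=; case: eqP => [-> /avv // | _].
exact: (av213P _ avp).
Qed.

(** * Inserting decreasing words of large letters *)

(* A letter exceeding all of [S1 ++ S2], inserted between them, plays the role
   of the 4 in no pattern: the cases are 213|, 23|1 and 2|13. *)
Definition room_for_max (S1 S2 : seq nat) :=
  [/\ forall a b c, subseq [:: a; b; c] S1 -> ~~ ((b < a) && (a < c)),
      forall a b c, subseq [:: a; b] S1 -> subseq [:: c] S2 ->
        ~~ ((c < a) && (a < b))
    & forall a b c, subseq [:: a] S1 -> subseq [:: b; c] S2 ->
        ~~ ((b < a) && (a < c))].

Lemma gtn_trans : transitive gtn.
Proof. by move=> x y z /= lt1 lt2; apply: ltn_trans lt2 lt1. Qed.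

Lemma sub_all_subseq (P : pred nat) t s : subseq t s -> all P s -> all P t.
Proof. by move=> /mem_subseq st /allP Ps; apply/allP => x /st /Ps. Qed.

(** With [v] as the 2, the patterns 2134 and 2341 need an ascent among the letters above [v], and
    2413 needs a smaller letter between two of them; but [D] is decreasing and contiguous. *)
Lemma bad_subseq_block v S1 D S2 :
    all (ltn^~ v) S1 -> all (ltn^~ v) S2 -> all (ltn v) D -> sorted gtn D ->
  forall b c d, subseq [:: b; c; d] (S1 ++ D ++ S2) -> ~~ bad v b c d.
Proof.
move=> v1 v2 vD sD b c d; do 2 rewrite !subseq_catE /=; move=> H; split_bools;
repeat match goal with
| H : is_true (subseq _ S1) |- _ => move: (sub_all_subseq H v1) => {}H
| H : is_true (subseq _ S2) |- _ => move: (sub_all_subseq H v2) => {}H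
| H : is_true (subseq _ D) |- _ => 
  move: (subseq_sorted gtn_trans H sD) (sub_all_subseq H vD) => {H} ? ?
end; rewrite /bad; bool_lia.
Qed.

(** An occurrence with two letters in the decreasing word [D] would have its 3 and 4 there. This
    excludes 2134 and 2341; in 2413 it puts the 1, hence all four letters, in [D], where 2 before 4
    is an ascent. So [D] supplies at most a 4, and the condition is the same for every [D], in
    particular for a single letter. *)
Lemma avT_insert_block m S1 D S2 :
    all (ltn^~ m) S1 -> all (ltn^~ m) S2 -> all (leq m) D ->
    sorted gtn D -> D != [::] ->
  avT (S1 ++ D ++ S2) <-> avT (S1 ++ S2) /\ room_for_max S1 S2.
Proof.
move=> m1 m2 mD sD.
case def_D: D => [|d D'] // _; rewrite -def_D.
have d_D : subseq [:: d] D by rewrite def_D sub1seq mem_head.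
have m_d : m <= d by move: mD; rewrite def_D => /andP[].
split=> [/avTP av | [/avTP av [r1 r2 r3]]].
  split; first by apply/avTP => a b c e st; apply: av;
    apply: subseq_trans st _; rewrite cat_subseq // suffix_subseq.
  split=> [a b c s1 | a b c s1 s2 | a b c s1 s2].
  - have := av _ _ _ _ (cat_subseq s1 (subseq_trans d_D (prefix_subseq D S2))).
    by have := sub_all_subseq s1 m1; move: m_d; clear; rewrite /bad /=; lia.
  - have := av _ _ _ _ (cat_subseq s1 (cat_subseq d_D s2)).
    have := sub_all_subseq s1 m1; have := sub_all_subseq s2 m2.
    by move: m_d; clear; rewrite /bad /=; lia.
  have := av _ _ _ _ (cat_subseq s1 (cat_subseq d_D s2)).
  have := sub_all_subseq s1 m1; have := sub_all_subseq s2 m2.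
  by move: m_d; clear; rewrite /bad /=; lia.
apply/avTP => a b c e; do 2 rewrite !subseq_catE /=; move=> H; split_bools;
  try (by apply: av; rewrite subseq_catE /= ?(H, H0, H1, orbT));
  repeat match goal with
  | H : is_true (subseq [:: _; _; _] S1) |- _ =>
     move: (r1 _ _ _ H) (sub_all_subseq H m1) => {H} ? ?
  | H : is_true (subseq [:: _; _] S1), H' : is_true (subseq [:: _] S2) |- _ =>
     move: (r2 _ _ _ H H') (sub_all_subseq H m1)
       (sub_all_subseq H' m2) => {H H'} ? ? ?
  | H : is_true (subseq [:: _] S1), H' : is_true (subseq [:: _; _] S2) |- _ =>
     move: (r3 _ _ _ H H') (sub_all_subseq H m1)
       (sub_all_subseq H' m2) => {H H'} ? ? ?
  | H : is_true (subseq _ S1) |- _ => move: (sub_all_subseq H m1) => {}H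
  | H : is_true (subseq _ S2) |- _ => move: (sub_all_subseq H m2) => {}H
  | H : is_true (subseq _ D) |- _ => 
    move: (subseq_sorted gtn_trans H sD) (sub_all_subseq H mD) => {H} ? ?
  end; rewrite /bad; bool_lia.
Qed.

Lemma avoids_subseq tau w1 w2 :
  subseq w1 w2 -> avoids tau w2 -> avoids tau w1.
Proof.
by move=> sw /avoidsP av; apply/avoidsP => t /subseq_trans st; apply/av/st.
Qed.

Lemma avT_subseq w1 w2 : subseq w1 w2 -> avT w2 -> avT w1.
Proof. by move=> sw; apply: sub_all => tau; apply: avoids_subseq. Qed.

Lemma split_prefix (P : pred nat) s :
  exists s1 s2, [/\ s = s1 ++ s2, all P s1
    & if s2 is x :: _ then ~~ P x else true].
Proof.
elim: s => [|x s [s1 [s2 [-> P1 P2]]]]; first by exists [::], [::].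
have [Px|nPx] := boolP (P x); last by exists [::], (x :: s1 ++ s2).
by exists (x :: s1), s2; split=> //=; rewrite Px.
Qed.

Lemma avT_cons_min v p : all (ltn v) p -> avT (v :: p) = avT p.
Proof.
move=> vp; apply/avT_cons/idP => [[] // | avp]; split=> // b c d sp.
have := sub_all_subseq sp vp; rewrite /bad /=; clear; lia.
Qed.

Lemma avT_cons_max v p : all (ltn^~ v) p -> avT (v :: p) = avT p.
Proof.
move=> vp; apply/avT_cons/idP => [[] // | avp]; split=> // b c d sp.
have := sub_all_subseq sp vp; rewrite /bad /=; clear; lia.
Qed.

(** Large letters after a small one lie in [w], those before one lie in [u], and both words
    decrease: no 2134 or 2341 starts at [v]. Two large letters around a small one come from [u] and
    then [w], so they increase: no 2413. *)
Lemma bad_subseq_interval v u S w :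
    all (ltn v) u -> sorted gtn u -> all (ltn^~ v) S ->
    all (ltn v) w -> sorted gtn w -> allrel ltn u w ->
  forall b c d, subseq [:: b; c; d] (u ++ S ++ w) -> ~~ bad v b c d.
Proof.
move=> vu su vS vw sw uw b c d.
have {}uw t1 t2 : subseq t1 u -> subseq t2 w ->
    all (fun x => all (ltn x) t2) t1.
  move=> /mem_subseq s1 /mem_subseq s2.
  apply/allP => x /s1 ux; apply/allP => y /s2 wy; exact: (allrelP uw).
do 2 rewrite !subseq_catE /=; move=> H; split_bools;
  try match goal with
  | H : is_true (subseq _ u), H' : is_true (subseq _ w) |- _ =>
    move: (uw _ _ H H') => ?
  end;
  repeat match goal with
  | H : is_true (subseq _ u) |- _ =>
    move: (subseq_sorted gtn_trans H su) (sub_all_subseq H vu) => {H} ? ?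
  | H : is_true (subseq _ w) |- _ =>
    move: (subseq_sorted gtn_trans H sw) (sub_all_subseq H vw) => {H} ? ?
  | H : is_true (subseq _ S) |- _ => move: (sub_all_subseq H vS) => {}H
  end; rewrite /bad; bool_lia.
Qed.

Lemma avT_block_shape v S1 D S2 :
    all (ltn^~ v) S1 -> all (ltn^~ v) S2 -> all (ltn v) D ->
    sorted gtn D -> D != [::] ->
  avT (v :: S1 ++ D ++ S2) <-> avT (S1 ++ S2) /\ room_for_max S1 S2.
Proof.
move=> v1 v2 vD sD D0.
have mD : all (leq v) D by apply: sub_all vD => x /ltnW.
rewrite -(avT_insert_block v1 v2 mD sD D0).
split=> [/avT_cons[] // | avp]; apply/avT_cons; split=> //.
exact: bad_subseq_block.
Qed.

(** A letter of [w] completes any 213 in [S] to a 2134. Neither [v] nor a letter of [u] starts a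
    pattern, so nothing more is required of [S]. *)
Lemma avT_interval_shape v u S w :
    all (ltn v) u -> sorted gtn u -> all (ltn^~ v) S ->
    all (ltn v) w -> sorted gtn w -> allrel ltn u w -> w != [::] ->
  avT (v :: u ++ S ++ w) = avoids [:: 2; 1; 3] S && avT S.
Proof.
move=> vu su vS vw sw uw w0.
(* With nothing after [w], [room_for_max] reduces to avoidance of 213 by [S]. *)
have av_Sw : avT (S ++ w) <-> avT S /\ room_for_max S [::].
  rewrite -[S ++ w]/(S ++ w) -{1}[w]cats0.
  rewrite (@avT_insert_block v) ?cats0 //.
  by apply: sub_all vw => x /ltnW.
have av_u : avT (u ++ S ++ w) = avT (S ++ w).
  (* The letters of [u] are added one by one in front: the later letters above such an [x] are those
     of [w], a decreasing suffix. *)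
  elim: u vu su uw => //= x u IHu /andP[vx vu] xu.
  rewrite allrel_consl => /andP[xw uw].
  have su : sorted gtn u := path_sorted xu.
  rewrite -(IHu vu su uw); apply/avT_cons/idP => [[] // | avp]; split=> //.
  have /allP ltux : all (gtn x) u := order_path_min gtn_trans xu.
  have xw' : all (ltn x) w by [].
  rewrite catA -[w]cats0; apply: bad_subseq_block => //.
  rewrite all_cat; apply/andP; split; first exact: order_path_min gtn_trans xu.
  by apply: sub_all vS => y /= lt_yv; apply: ltn_trans vx.
apply/idP/idP => [/avT_cons[] | avp].
  rewrite av_u => /av_Sw[avS [r1 _ _]] _; by rewrite avS andbT; apply/av213P.
have {}avp : avT (u ++ S ++ w).
  rewrite av_u; apply/av_Sw; move: avp => /andP[/av213P av3 avS]; split=> //.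
by apply/avT_cons; split=> //; apply: bad_subseq_interval.
Qed.

(** * The shape of an avoider, given its first letter *)

Lemma sorted_gtn_subseq s :
  (forall x y, subseq [:: x; y] s -> y < x) -> sorted gtn s.
Proof.
elim: s => [|x [|y s] IHs] // lt_s; apply/andP; split.
  by apply: lt_s; rewrite /= !eqxx sub0seq.
by apply: IHs => x' y' /subseq_trans sxy; apply/lt_s/sxy/subseq_cons.
Qed.

Lemma avT_head_shape v p :
    avT (v :: p) -> uniq (v :: p) -> has (ltn^~ v) p -> has (ltn v) p ->
  (exists S1 D S2, p = S1 ++ D ++ S2 /\
     [/\ all (ltn^~ v) S1, all (ltn^~ v) S2, all (ltn v) D, sorted gtn D
       & D != [::]]) \/
  (exists u S w, p = u ++ S ++ w /\
     [/\ all (ltn v) u, sorted gtn u, all (ltn^~ v) S &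
     [/\ all (ltn v) w, sorted gtn w, allrel ltn u w, u != [::] & w != [::]]]).
Proof.
move=> /avT_cons[_ av] /= /andP[v_p p_uniq] small large.
(* With [v] as 2 and [s] as 1, each pattern fixes the order of two large letters; uniqueness
   excludes equality. *)
have lt134 s d e : subseq [:: s; d; e] p -> s < v -> v < d -> v < e -> e < d.
  move=> sp; have := av _ _ _ sp; have := subseq_uniq sp p_uniq.
  rewrite /bad /= !inE; clear; lia.
have lt341 s d e : subseq [:: d; e; s] p -> s < v -> v < d -> v < e -> e < d.
  move=> sp; have := av _ _ _ sp; have := subseq_uniq sp p_uniq.
  rewrite /bad /= !inE; clear; lia.
have lt413 s d e : subseq [:: d; s; e] p -> s < v -> v < d -> v < e -> d < e.
  move=> sp; have := av _ _ _ sp; have := subseq_uniq sp p_uniq.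
  rewrite /bad /= !inE; clear; lia.
have lt_v x : x \in p -> ~~ (v < x) -> x < v.
  by move=> px; case: ltngtP => // def_x; rewrite def_x px in v_p.
have gt_v x : x \in p -> ~~ (x < v) -> v < x.
  by move=> px; case: ltngtP => // def_x; rewrite -def_x px in v_p.
(* [u] is the longest prefix of large letters, [s] the first small letter, and [S] the longest run
   of small letters from there. *)
have [u [q [def_p u_large]]] := split_prefix (ltn v) p.
case: q def_p => [|s r] def_p => [_ | /lt_v s_small].
  move: small; rewrite def_p cats0 => /hasP[x /(allP u_large) /= vx xv]; lia.
have {}s_small : s < v by apply: s_small; rewrite def_p mem_cat mem_head orbT.
have [S [q [def_q S_small]]] := split_prefix (ltn^~ v) (s :: r).
have s_S : (if q is x :: _ then ~~ (x < v) else true) -> subseq [:: s] S.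
  case: S def_q {S_small} => [/= <- | x S [<- _] _]; first by rewrite s_small.
  by rewrite sub1seq mem_head.
(* If no large letter follows [S], the large letters are the block [u] at the front. *)
case: q def_q s_S => [|d r1] def_q => [/(_ isT) s_S _ | s_S d_large].
  left; exists [::], u, S; rewrite def_p def_q cats0; split=> //.
  have u0 : u != [::].
    apply: contraL large => /eqP u0; rewrite def_p def_q u0 cats0 /= -all_predC.
    by apply: sub_all S_small => x /=; lia.
  split=> //; apply: sorted_gtn_subseq => x y su; apply: (lt341 s) => //.
  - by rewrite def_p (@cat_subseq _ [:: x; y] [:: s]) // def_q cats0.
  - by apply: (allP u_large); apply: (mem_subseq su); rewrite mem_head.
  - by apply: (allP u_large); apply: (mem_subseq su); rewrite !inE eqxx orbT.
have {}s_S := s_S d_large.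
have {}d_large : v < d.
  by apply: gt_v => //; rewrite def_p def_q !mem_cat mem_head !orbT.
have sub_ge v' x y t : all (ltn v') t -> subseq [:: x; y] t -> v' < x /\ v' < y.
  by move=> t_large /mem_subseq st; split; apply: (allP t_large); apply: st;
    rewrite !inE eqxx ?orbT.
(* With [u] empty, [D] is the run of large letters from [d]. A later large [e] would follow some
   small [s'], so that [s d e] forces [e < d] and [d s' e] forces [d < e]. *)
case: u def_p u_large => [|d0 u] def_p u_large.
  have [D [S2 [def_Q D_large S2_head]]] := split_prefix (ltn v) (d :: r1).
  have d_D : subseq [:: d] D.
    case: D def_Q {D_large} S2_head => [/= <- | x D [<- _] _].
      by rewrite d_large.
    by rewrite sub1seq mem_head.
  have {}def_p : p = S ++ D ++ S2 by rewrite def_p def_q def_Q.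
  left; exists S, D, S2; split=> //; split=> //; last first.
  - by apply: contraTneq d_D => ->.
  - apply: sorted_gtn_subseq => x y sD.
    have [vx vy] := sub_ge _ _ _ _ D_large sD.
    apply: (lt134 s) => //.
    by rewrite def_p (@cat_subseq _ [:: s] [:: x; y]) // -[[:: x; y]]cats0
      cat_subseq ?sub0seq.
  case: S2 S2_head {def_Q} def_p => [|s' S2] // s'_small def_p.
  have {}s'_small : s' < v.
    by apply: lt_v => //; rewrite def_p !mem_cat mem_head !orbT.
  apply/allP => e; rewrite inE => /predU1P[-> // | S2e].
  have e_S2 : subseq [:: e] S2 by rewrite sub1seq.
  apply: lt_v => [|]; last apply/negP => ve.
    by rewrite def_p !mem_cat inE S2e !orbT.
  have sub1 : subseq [:: s; d; e] p.
    rewrite def_p (@cat_subseq _ [:: s] [:: d; e]) //.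
    rewrite (@cat_subseq _ [:: d] [:: e]) //.
    by rewrite (subseq_trans e_S2) ?subseq_cons.
  have sub2 : subseq [:: d; s'; e] p.
    rewrite def_p (@cat_subseq _ [::] [:: d; s'; e]) ?sub0seq //.
    by rewrite (@cat_subseq _ [:: d] [:: s'; e]) //= eqxx.
  have := lt413 _ _ _ sub2 s'_small d_large ve.
  by rewrite ltnNge ltnW // (lt134 _ _ _ sub1).
right; exists (d0 :: u), S, (d :: r1); rewrite def_p def_q; split=> //.
set u' := d0 :: u in def_p u_large *; set w := d :: r1 in def_p def_q *.
have vd0 : v < d0 by case/andP: u_large.
rewrite def_q in def_p.
have sub_p t1 t2 t3 : subseq t1 u' -> subseq t2 S -> subseq t3 w ->
    subseq (t1 ++ t2 ++ t3) p.
  by move=> su sS sw; rewrite def_p !cat_subseq.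
have d0_u : subseq [:: d0] u' by rewrite sub1seq mem_head.
have d_w : subseq [:: d] w by rewrite sub1seq mem_head.
(* With [u] nonempty, nothing small follows [d]: a small [s'] would give [d < d0] by [d0 d s'],
   against [d0 < d] by [d0 s d]. *)
have w_large : all (ltn v) w.
  apply/allP => s' ws'; apply: gt_v => [|]; last apply/negP => s'_small.
    by rewrite def_p !mem_cat ws' !orbT.
  have s'_r1 : subseq [:: s'] r1.
    move: ws'; rewrite sub1seq inE => /predU1P[def_s'|//].
    by move: s'_small; rewrite def_s' ltnNge ltnW.
  have s'_w : subseq [:: d; s'] w by rewrite /= eqxx.
  have sub1 : subseq [:: d0; d; s'] p := sub_p _ [::] _ d0_u (sub0seq _) s'_w.
  have sub2 : subseq [:: d0; s; d] p := sub_p _ _ _ d0_u s_S d_w.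
  have := lt413 _ _ _ sub2 s_small vd0 d_large.
  by rewrite ltnNge ltnW // (lt341 _ _ _ sub1).
split=> //; [|split=> //].
- apply: sorted_gtn_subseq => x y su; have [vx vy] := sub_ge _ _ _ _ u_large su.
  by apply: (lt341 s) => //; apply: (sub_p [:: x; y] [:: s] [::]).
- apply: sorted_gtn_subseq => x y sw; have [vx vy] := sub_ge _ _ _ _ w_large sw.
  by apply: (lt134 s) => //; apply: (sub_p [::] [:: s] [:: x; y]).
apply/allrelP => x y ux wy; apply: (lt413 s) => //.
- by apply: (sub_p [:: x] [:: s] [:: y]) => //; rewrite sub1seq.
- exact: (allP u_large).
exact: (allP w_large).
Qed.

(** * Avoiders that also avoid 213 *)

Definition av213T (w : seq nat) := avoids [:: 2; 1; 3] w && avT w.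

(** Every letter of [L] exceeds all later ones, so it starts no 213, and after [v] the larger
    letters precede the smaller ones. *)
Lemma av213T_cons_shape v L S :
    all (ltn v) L -> sorted gtn L -> all (ltn^~ v) S ->
  av213T (v :: L ++ S) = av213T S.
Proof.
move=> vL sL vS; apply/idP/idP => [/andP[av3 avt] | /andP[av3 avt]].
  have sS : subseq S (v :: L ++ S) by apply: (suffix_subseq (v :: L)).
  by rewrite /av213T (avoids_subseq sS av3) (avT_subseq sS avt).
have avp : avoids [:: 2; 1; 3] (L ++ S).
  apply/av213P => a b c; rewrite subseq_catE /= => H; split_bools;
  try exact: (av213P _ av3);
  repeat match goal with
  | H : is_true (subseq _ L) |- _ =>
    move: (subseq_sorted gtn_trans H sL) (sub_all_subseq H vL) => {H} ? ?
  | H : is_true (subseq _ S) |- _ => move: (sub_all_subseq H vS) => {}H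
  end; bool_lia.
apply/andP; split.
  apply/av213_cons; split=> // b c; rewrite subseq_catE /= => H; split_bools;
  repeat match goal with
  | H : is_true (subseq _ L) |- _ => move: (sub_all_subseq H vL) => {}H
  | H : is_true (subseq _ S) |- _ => move: (sub_all_subseq H vS) => {}H
  end; bool_lia.
have [-> | L0] := eqVneq L [::]; first by rewrite avT_cons_max.
by apply/(avT_block_shape (S1 := [::]) (v := v)).
Qed.

(** With [v] as the 2, avoiding 213 puts every large letter before every small one: in the first
    shape [S1] is empty, and the second is impossible. *)
Lemma av213T_head_shape v p :
    av213T (v :: p) -> uniq (v :: p) -> has (ltn^~ v) p ->
  exists L S, [/\ p = L ++ S, all (ltn v) L, sorted gtn L & all (ltn^~ v) S].
Proof.
move=> /andP[/av213_cons[_ av3] avt] v_p small.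
have [large | /hasPn small_p] := boolP (has (ltn v) p); last first.
  exists [::], p; split=> //; apply/allP => x px; have := small_p x px => /=.
  by case: ltngtP => // def_x; move: v_p; rewrite /= def_x px.
have [] := avT_head_shape avt v_p small large.
  move=> [S1 [D [S2 [def_p [s1 s2 vD sD]]]]].
  case: D vD sD def_p => // d D vD sD def_p _.
  exists (d :: D), S2; case: S1 s1 def_p => // s S1 s1 def_p.
  have vd : v < d by case/andP: vD.
  have sv : s < v by case/andP: s1.
  have := av3 s d; rewrite {}def_p sv -[[:: s; d]]/([:: s] ++ [:: d]).
  rewrite cat_subseq ?sub1seq ?mem_cat ?mem_head ?orbT //.
  by move=> /(_ isT); rewrite vd.
move=> [[|d u] [S [[|e w] [def_p [u1 u2 s1 [w1 w2 uw] //]]]]] _ _.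
have [s ps sv] : exists2 s, s \in p & s < v := hasP small.
have Ss : s \in S.
  move: ps; rewrite def_p !mem_cat.
  by case/or3P=> [/(allP u1) /= | // | /(allP w1) /=]; move: sv; clear; lia.
have ve : v < e by case/andP: w1.
have := av3 s e.
rewrite {}def_p sv ve -[[:: s; e]]/([::] ++ [:: s] ++ [:: e]).
by rewrite !cat_subseq ?sub0seq ?sub1seq ?mem_head // => /(_ isT).
Qed.

(** * Decreasing blocks, and lists of words by first letter *)

Definition block v i := rev (iota v i).

Lemma sorted_block v i : sorted gtn (block v i).
Proof. by rewrite rev_sorted iota_ltn_sorted. Qed.

Lemma mem_block v i x : (x \in block v i) = (v <= x < v + i).
Proof. by rewrite mem_rev mem_iota. Qed.

Lemma block_neq0 v i : 0 < i -> block v i != [::].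
Proof.
by case: i => // i _; rewrite /block /= rev_cons -size_eq0 size_rcons.
Qed.

Lemma perm_block v i : perm_eq (block v i) (iota v i).
Proof. by rewrite perm_rev. Qed.

Lemma sorted_perm_block v i D :
  sorted gtn D -> perm_eq D (iota v i) -> D = block v i.
Proof.
move=> sD pD; apply: (irr_sorted_eq gtn_trans) => //.
- exact: ltnn.
- exact: sorted_block.
by move=> x; rewrite (perm_mem pD) mem_rev.
Qed.

Definition words (P : pred (seq nat)) n :=
  [seq w <- permutations (iota 0 n) | P w].

Lemma mem_words P n w : (w \in words P n) = P w && perm_eq w (iota 0 n).
Proof. by rewrite mem_filter mem_permutations. Qed.

Lemma words_uniq P n : uniq (words P n).
Proof. by rewrite filter_uniq // permutations_uniq. Qed.

Definition words_head (P : pred (seq nat)) v n :=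
  [seq w <- words P n | head 0 w == v].

Lemma size_words_head P n :
  size (words P n.+1) = \sum_(v < n.+1) size (words_head P v n.+1).
Proof.
rewrite -sum1_size.
(* [inord] loses nothing here, since the first letter is at most [n]. *)
rewrite (partition_big (fun w => inord (head 0 w) : 'I_n.+1) xpredT) //=.
apply: eq_bigr => v _; rewrite size_filter -sum1_count.
rewrite big_seq_cond [RHS]big_seq_cond; apply: eq_bigl => w.
have [|//] := boolP (w \in _); rewrite mem_words => /andP[_ pw] /=.
rewrite -val_eqE /= inordK //.
have: all (ltn^~ n.+1) w by apply/allP => x; rewrite (perm_mem pw) mem_iota.
by case: w pw => [|x w] _ //= /andP[].
Qed.

(** Lengths take the form [(v + l).+1]: there are [v] letters below the first letter [v] and [l]
    above it. *)
Lemma perm_cons_iota v l p :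
  perm_eq (v :: p) (iota 0 (v + l).+1) =
  perm_eq p (iota 0 v ++ iota v.+1 l).
Proof.
rewrite -addnS iotaD add0n /= perm_sym -cat1s perm_catCA /= perm_cons.
by rewrite perm_sym.
Qed.

Lemma filter_all_disjoint (P Q : pred nat) s :
  (forall x, P x -> ~~ Q x) -> all P s -> filter Q s = [::].
Proof.
move=> PQ /(sub_all PQ); rewrite all_predC has_filter negbK.
by move/eqP.
Qed.

Lemma perm_cat_iota v l S L p :
    all (ltn^~ v) S -> all (ltn v) L -> perm_eq p (S ++ L) ->
  perm_eq p (iota 0 v ++ iota v.+1 l) =
  perm_eq S (iota 0 v) && perm_eq L (iota v.+1 l).
Proof.
move=> vS vL /permPl->; apply/idP/andP => [pp | [pS pL]]; last exact: perm_cat.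
have v1 : all (ltn^~ v) (iota 0 v) by apply/allP => x; rewrite mem_iota.
have v2 : all (ltn v) (iota v.+1 l).
  by apply/allP => x; rewrite mem_iota => /andP[].
have noS s : all (ltn v) s -> filter (ltn^~ v) s = [::].
  by apply: filter_all_disjoint => x /=; lia.
have noL s : all (ltn^~ v) s -> filter (ltn v) s = [::].
  by apply: filter_all_disjoint => x /=; lia.
have := perm_filter (ltn^~ v) pp; have := perm_filter (ltn v) pp.
rewrite !filter_cat (noS L) // (noS _ v2) (noL S) // (noL _ v1) /= !cats0.
by rewrite !(all_filterP _).
Qed.

Lemma uniq_size_eqi (X : eqType) (s1 s2 : seq X) :
  uniq s1 -> uniq s2 -> s1 =i s2 -> size s1 = size s2.
Proof. by move=> u1 u2 e; apply/perm_size/uniq_perm. Qed.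

Lemma words_head_uniq P v n : uniq (words_head P v n).
Proof. by rewrite filter_uniq // words_uniq. Qed.

Lemma mem_words_head (P : pred (seq nat)) v l w :
  reflect (exists p, [/\ w = v :: p, P (v :: p)
                       & perm_eq p (iota 0 v ++ iota v.+1 l)])
    (w \in words_head P v (v + l).+1).
Proof.
rewrite mem_filter mem_words; apply: (iffP and3P) => [[] | [p [-> Pp pp]]].
  case: w => [|x p] /= /eqP <- Pp; last first.
    by rewrite perm_cons_iota => pp; exists p.
  by move/perm_size.
by rewrite /= eqxx perm_cons_iota.
Qed.

Lemma size_words_head0 (P : pred (seq nat)) n :
    (forall w, P (0 :: map S w) = P w) ->
  size (words_head P 0 n.+1) = size (words P n).
Proof.
move=> PS; rewrite -[RHS](size_map (fun w => 0 :: map S w)).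
have iota1 : iota 1 n = map S (iota 0 n) by rewrite -(iotaDl 1 0).
apply: uniq_size_eqi; first exact: words_head_uniq.
  rewrite map_inj_uniq ?words_uniq // => w1 w2 [].
  exact: (inj_map succn_inj).
move=> w; apply/(mem_words_head P 0 n)/mapP => [[p [-> Pp pp]] | [q]].
  have def_p : map S (map predn p) = p.
    rewrite -map_comp -[RHS]map_id; apply/eq_in_map => x /=.
    by rewrite (perm_mem pp) mem_iota; case: x.
  exists (map predn p); last by rewrite def_p.
  rewrite mem_words -PS def_p Pp; apply: (perm_map_inj succn_inj).
  by rewrite def_p -iota1.
rewrite mem_words => /andP[Pq pq] ->; exists (map S q).
by rewrite PS Pq /= iota1 perm_map.
Qed.

Lemma size_words_head_max n :
  size (words_head avT n n.+1) = size (words avT n).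
Proof.
rewrite -[RHS](size_map (cons n)).
have max_p p : perm_eq p (iota 0 n) -> avT (n :: p) = avT p.
  move=> pp; apply: avT_cons_max; apply/allP => x.
  by rewrite (perm_mem pp) mem_iota.
apply: uniq_size_eqi; first exact: words_head_uniq.
  by rewrite map_inj_uniq ?words_uniq // => w1 w2 [].
move=> w; rewrite -[X in words_head _ _ X.+1]addn0.
apply/mem_words_head/mapP => [[p] | [p]].
  rewrite cats0 => -[-> Pp pp]; exists p => //.
  by rewrite mem_words -max_p ?Pp.
rewrite mem_words => /andP[Pp pp] ->; exists p.
by rewrite cats0 max_p.
Qed.

(** For [v > 0] the large letters form the decreasing block right after [v], so only the word of
    small letters is free. For [v = 0] no small letter forces this. *)
Lemma size_words_head_av213T v l : 0 < v ->
  size (words_head av213T v (v + l).+1) = size (words av213T v).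
Proof.
move=> v_gt0; rewrite -[RHS](size_map (fun w => v :: block v.+1 l ++ w)).
apply: uniq_size_eqi; first exact: words_head_uniq.
  rewrite map_inj_uniq ?words_uniq // => w1 w2 [] /eqP.
  by rewrite eqseq_cat // eqxx => /eqP.
have v_block : all (ltn v) (block v.+1 l).
  by apply/allP => x; rewrite mem_block => /andP[].
move=> w; apply/mem_words_head/mapP => [[p [-> Pp pp]] | [S]].
  have vp_uniq : uniq (v :: p).
    have := iota_uniq 0 (v + l).+1.
    by rewrite -(perm_uniq (s1 := v :: p)) // perm_cons_iota.
  have small : has (ltn^~ v) p.
    by apply/hasP; exists 0; rewrite // (perm_mem pp) mem_cat mem_iota v_gt0.
  have [L [S [def_p vL sL vS]]] := av213T_head_shape Pp vp_uniq small.
  have pSL : perm_eq p (S ++ L) by rewrite def_p perm_catC.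
  have := pp; rewrite (perm_cat_iota l vS vL pSL) => /andP[pS pL].
  have def_L := sorted_perm_block sL pL.
  exists S; last by rewrite def_p def_L.
  by rewrite mem_words pS andbT -(av213T_cons_shape vL sL vS) -def_p.
rewrite mem_words => /andP[PS pS] ->.
have vS : all (ltn^~ v) S.
  by apply/allP => x; rewrite (perm_mem pS) mem_iota.
exists (block v.+1 l ++ S); split=> //.
  by rewrite av213T_cons_shape // sorted_block.
by rewrite perm_catC perm_cat // perm_block.
Qed.

(** * Contraction of a block, and the two families of avoiders *)

Definition expand v l (w : seq nat) :=
  flatten [seq (if x == v then block v.+1 l else [:: x]) | x <- w].

(** Undoes [expand]: of the block only the least letter [v.+1] is kept, renamed [v]. *)
Definition collapse v (w : seq nat) :=
  [seq (if x == v.+1 then v else x) | x <- w & x <= v.+1].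

Lemma expand_cat v l S1 S2 : all (ltn^~ v) S1 -> all (ltn^~ v) S2 ->
  expand v l (S1 ++ v :: S2) = S1 ++ block v.+1 l ++ S2.
Proof.
have expand_id s : all (ltn^~ v) s -> expand v l s = s.
  elim: s => //= x s IHs /andP[ltxv /IHs]; rewrite /expand /= => ->.
  by rewrite ltn_eqF.
move=> v1 v2; rewrite /expand map_cat flatten_cat /= eqxx.
by rewrite -!/(expand v l _) !expand_id.
Qed.

Lemma collapse_cat v l S1 S2 : 0 < l ->
    all (ltn^~ v) S1 -> all (ltn^~ v) S2 ->
  collapse v (S1 ++ block v.+1 l ++ S2) = S1 ++ v :: S2.
Proof.
move=> l_gt0 v1 v2.
have collapse_id s : all (ltn^~ v) s -> collapse v s = s.
  elim: s => //= x s IHs /andP[ltxv /IHs]; rewrite /collapse /=.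
  rewrite (leq_trans (ltnW ltxv)) //= => ->.
  by rewrite ltn_eqF // ltnS ltnW.
have collapse_block : collapse v (block v.+1 l) = [:: v].
  case: l l_gt0 => // l _; rewrite /collapse /block filter_rev /= leqnn.
  rewrite (@eq_in_filter _ _ pred0) ?filter_pred0 /= ?eqxx // => x.
  by rewrite mem_iota => /andP[ltvx _]; rewrite leqNgt ltvx.
rewrite /collapse !filter_cat !map_cat -!/(collapse v _).
by rewrite collapse_block !collapse_id.
Qed.

Lemma perm_cons_iota_max v p :
  perm_eq (v :: p) (iota 0 v.+1) = perm_eq p (iota 0 v).
Proof. by have := perm_cons_iota v 0 p; rewrite addn0 cats0. Qed.

Lemma words_split_max P v w : w \in words P v.+1 ->
  exists S1 S2, [/\ w = S1 ++ v :: S2, all (ltn^~ v) S1, all (ltn^~ v) S2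
     & perm_eq (S1 ++ S2) (iota 0 v)].
Proof.
rewrite mem_words => /andP[_ pw].
have vw : v \in w by rewrite (perm_mem pw) mem_iota add0n ltnSn.
case/splitPr: vw pw => S1 S2.
rewrite -cat1s perm_catCA perm_cons_iota_max => pS.
have: all (ltn^~ v) (S1 ++ S2).
  by apply/allP => x; rewrite (perm_mem pS) mem_iota.
by rewrite all_cat => /andP[? ?]; exists S1, S2.
Qed.

Definition block_words v l :=
  [seq v :: expand v l w | w <- words avT v.+1].

(** [i] is the length of the first decreasing word; it runs from 1 to [l - 1] because both words are
    nonempty. *)
Definition interval_words v l :=
  [seq v :: block v.+1 i ++ s ++ block (v.+1 + i) (l - i)
     | i <- iota 1 l.-1, s <- words av213T v].

Lemma block_words_uniq v l : 0 < l -> uniq (block_words v l).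
Proof.
move=> l_gt0; rewrite map_inj_in_uniq ?words_uniq // => w1 w2.
move=> /words_split_max[S1 [S2 [-> s1 s2 _]]].
move=> /words_split_max[S3 [S4 [-> s3 s4 _]]].
rewrite !expand_cat // => -[] eq_w.
by rewrite -(collapse_cat l_gt0 s1 s2) eq_w collapse_cat.
Qed.

Lemma nth_block i v l : i < l -> nth 0 (block v l) i = v + (l - i.+1).
Proof.
move=> lt_il; rewrite nth_rev size_iota // nth_iota //; lia.
Qed.

Lemma interval_words_uniq v l : uniq (interval_words v l).
Proof.
apply: allpairs_uniq; rewrite ?iota_uniq ?words_uniq // => x1 x2.
move=> /allpairsP[[i S] [/= i_l S_v ->]].
move=> /allpairsP[[j U] [/= j_l U_v ->]] [eq_w].
move: i_l j_l; rewrite !mem_iota => /andP[i_gt0 lt_i] /andP[j_gt0 lt_j].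
(* The letter after the leading [v] is [v + i]. *)
have eq_ij : i = j.
  have := congr1 (fun w => nth 0 w 0) eq_w.
  rewrite !nth_cat !size_rev !size_iota i_gt0 j_gt0 !nth_block //; lia.
move: eq_w; rewrite eq_ij => /eqP; rewrite eqseq_cat // eqxx /= => /eqP eq_w.
have eq_SU : size S = size U.
  by have := congr1 size eq_w; rewrite !size_cat; lia.
by move/eqP: eq_w; rewrite eqseq_cat // => /andP[/eqP->].
Qed.

(** Separates the two families: here the large letters form, in order, the whole decreasing block;
    in [interval_words] the first of them is [v + i] with [i < l]. *)
Lemma large_block_words v l w : w \in block_words v l ->
  [seq x <- w | v < x] = block v.+1 l.
Proof.
case/mapP => w' /words_split_max[S1 [S2 [-> s1 s2 _]]] ->.
rewrite expand_cat //= ltnn !filter_cat.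
have noS s : all (ltn^~ v) s -> [seq x <- s | v < x] = [::].
  by apply: filter_all_disjoint => x /=; lia.
rewrite (noS S1) // (noS S2) // cats0.
by apply/all_filterP/allP => x; rewrite mem_block => /andP[].
Qed.

Lemma large_interval_words v l w : w \in interval_words v l ->
  [seq x <- w | v < x] <> block v.+1 l.
Proof.
case/allpairsP => -[i S] [/=]; rewrite mem_iota => /andP[i_gt0 lt_i] _ ->.
move/(congr1 (fun s => nth 0 s 0)); rewrite /= ltnn filter_cat.
have -> : [seq x <- block v.+1 i | v < x] = block v.+1 i.
  by apply/all_filterP/allP => x; rewrite mem_block => /andP[].
rewrite nth_cat size_rev size_iota i_gt0 !nth_block //; lia.
Qed.

Lemma mem_words_head_avT v l w : 0 < v -> 0 < l ->
  (w \in words_head avT v (v + l).+1) =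
  (w \in block_words v l) || (w \in interval_words v l).
Proof.
move=> v_gt0 l_gt0.
have large_block i : all (ltn v) (block v.+1 i).
  by apply/allP => x; rewrite mem_block => /andP[].
apply/mem_words_head/orP => [[p [-> Pp pp]] | []].
- have vp_uniq : uniq (v :: p).
    have := iota_uniq 0 (v + l).+1.
    by rewrite -(perm_uniq (s1 := v :: p)) // perm_cons_iota.
  have small : has (ltn^~ v) p.
    by apply/hasP; exists 0; rewrite // (perm_mem pp) mem_cat mem_iota v_gt0.
  have large : has (ltn v) p.
    apply/hasP; exists v.+1; rewrite //= (perm_mem pp) mem_cat !mem_iota.
    by move: l_gt0; clear; lia.
  have [] := avT_head_shape Pp vp_uniq small large.
    move=> [S1 [D [S2 [def_p [s1 s2 vD sD D0]]]]]; left.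
    have s12 : all (ltn^~ v) (S1 ++ S2) by rewrite all_cat s1.
    have pSD : perm_eq p ((S1 ++ S2) ++ D).
      by rewrite def_p -catA perm_cat2l perm_catC.
    have := pp; rewrite (perm_cat_iota l s12 vD pSD) => /andP[pS pD].
    have def_D := sorted_perm_block sD pD.
    apply/mapP; exists (S1 ++ v :: S2); last first.
      by rewrite expand_cat // def_p def_D.
    rewrite mem_words -cat1s (perm_catCA S1) perm_cons_iota_max pS andbT.
    (* The contracted word is subject to the same condition on [S1] and [S2] as [v :: p], with
       [[:: v]] in place of [D]. *)
    apply/(avT_insert_block (m := v)) => //=; first by rewrite leqnn.
    by apply/(avT_block_shape s1 s2 vD sD D0); rewrite -def_p.
  move=> [u [S [U [def_p [vu su vS [vU sU uU u0 U0]]]]]]; right.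
  have vL : all (ltn v) (u ++ U) by rewrite all_cat vu.
  have pSL : perm_eq p (S ++ (u ++ U)) by rewrite def_p perm_catCA.
  have := pp; rewrite (perm_cat_iota l vS vL pSL) => /andP[pS pL].
  (* [rev u ++ rev U] is increasing, so it is the interval itself; hence the length of [u]
     determines [u] and [U]. *)
  have eq_uU : rev u ++ rev U = iota v.+1 l.
    apply: (irr_sorted_eq ltn_trans ltnn); last 1 first.
    + by move=> x; rewrite -(perm_mem pL) !mem_cat !mem_rev.
    + rewrite (sorted_pairwise ltn_trans) pairwise_cat.
      rewrite -!(sorted_pairwise ltn_trans) !rev_sorted su sU !andbT.
      apply/allrelP => x y; rewrite !mem_rev; exact: (allrelP uU).
    exact: iota_ltn_sorted.
  have size_uU := congr1 size eq_uU.
  rewrite size_cat !size_rev size_iota in size_uU.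
  have u_gt0 : 0 < size u by rewrite lt0n size_eq0.
  have U_gt0 : 0 < size U by rewrite lt0n size_eq0.
  have def_u : u = block v.+1 (size u).
    have := congr1 (take (size u)) eq_uU; rewrite take_size_cat ?size_rev //.
    rewrite take_iota -size_uU (minn_idPl _) ?leq_addr // /block => <-.
    by rewrite revK.
  have def_U : U = block (v.+1 + size u) (l - size u).
    have := congr1 (drop (size u)) eq_uU; rewrite drop_size_cat ?size_rev //.
    by rewrite drop_iota => eq_U; rewrite /block -eq_U revK.
  apply/allpairsP; exists (size u, S); split=> /=.
  + by rewrite mem_iota u_gt0; move: U_gt0 size_uU; clear; lia.
  + rewrite mem_words pS andbT /av213T.
    by rewrite -(avT_interval_shape vu su vS vU sU uU U0) -def_p.
  by rewrite -def_u -def_U -def_p.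
- case/mapP => w' w'T ->.
  have [S1 [S2 [def_w s1 s2 pS]]] := words_split_max w'T.
  rewrite {1}def_w expand_cat //; exists (S1 ++ block v.+1 l ++ S2).
  have D0 := @block_neq0 v.+1 l l_gt0.
  move: w'T; rewrite mem_words => /andP[Pw' _].
  split=> //.
    apply/(avT_block_shape s1 s2 (large_block l) (sorted_block _ _) D0).
    apply/(avT_insert_block (m := v) (D := [:: v])) => //=.
      by rewrite leqnn.
    by rewrite -def_w.
  by rewrite perm_catCA perm_catC perm_cat // perm_block.
case/allpairsP => -[i S] [/=]; rewrite mem_iota => /andP[i_gt0 lt_i].
rewrite mem_words => /andP[PS pS] ->.
have vS : all (ltn^~ v) S.
  by apply/allP => x; rewrite (perm_mem pS) mem_iota.
exists (block v.+1 i ++ S ++ block (v.+1 + i) (l - i)); split=> //.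
  rewrite (avT_interval_shape (large_block i)) ?sorted_block ?block_neq0 //.
  - by apply/allP => x; rewrite mem_block => /andP[/= lt_x _]; lia.
  - by apply/allrelP => x y; rewrite !mem_block /=; lia.
  lia.
rewrite perm_catCA perm_cat //.
have -> : l = i + (l - i) by lia.
by rewrite iotaD perm_cat ?perm_block // addKn perm_block.
Qed.

Lemma size_words_head_avT v l : 0 < v -> 0 < l ->
  size (words_head avT v (v + l).+1) =
  size (words avT v.+1) + l.-1 * size (words av213T v).
Proof.
move=> v_gt0 l_gt0.
have -> : size (words avT v.+1) + l.-1 * size (words av213T v) =
    size (block_words v l ++ interval_words v l).
  by rewrite size_cat size_map size_allpairs size_iota.
apply: uniq_size_eqi; first exact: words_head_uniq.
  rewrite cat_uniq block_words_uniq // interval_words_uniq andbT /=.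
  apply/hasPn => w /large_interval_words neq_w.
  apply/negP => /large_block_words.
  exact: neq_w.
by move=> w; rewrite mem_cat mem_words_head_avT.
Qed.

(** * Shifts of letters, and permutations as words *)

Lemma avT_map_succn w : avT (map S w) = avT w.
Proof. by apply: eq_all => tau; apply: avoids_map. Qed.

Lemma avT_shift w : avT (0 :: map S w) = avT w.
Proof.
rewrite avT_cons_min ?avT_map_succn //.
by apply/allP => _ /mapP[x _ ->].
Qed.

Lemma av213T_shift w : av213T (0 :: map S w) = av213T w.
Proof.
rewrite /av213T avT_shift; congr (_ && _).
rewrite -(avoids_map [:: 2; 1; 3] w (f := S)) //.
by apply/av213_cons/idP => [[] // | avw]; split.
Qed.

(** A permutation is identified with its word of values from 0; [one_line] shifts the letters by
    one, and avoidance is invariant under the shift. *)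
Lemma card_avoiders n : #|avoiders T n| = size (words avT n).
Proof.
pose vals (pi : 'S_n) := [seq val (pi i) | i <- enum 'I_n].
have avE (pi : 'S_n) : (pi \in avoiders T n) = avT (vals pi).
  by rewrite inE -avT_map_succn /vals -map_comp.
have vals_inj : injective vals.
  move=> pi rho /eq_in_map eq_vals; apply/permP => i.
  by apply/val_inj/eq_vals; rewrite mem_enum.
rewrite cardE -(size_map vals); apply: uniq_size_eqi.
- by rewrite map_inj_uniq ?enum_uniq.
- exact: words_uniq.
move=> w; rewrite mem_words; apply/mapP/andP => [[pi] | [avw pw]].
  rewrite mem_enum avE => avp ->; split=> //.
  rewrite -val_enum_ord /vals (map_comp val pi); apply: perm_map.
  apply: uniq_perm; rewrite ?(map_inj_uniq perm_inj) ?enum_uniq // => i.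
  rewrite mem_enum; apply/mapP; exists (pi^-1 i)%g.
    by rewrite mem_enum.
  by rewrite permKV.
have size_n : size (iota 0 n) == n by rewrite size_iota.
have /tuple_permP[pi def_w] : perm_eq w (Tuple size_n) by [].
have eq_w : w = vals pi.
  rewrite def_w /= /vals; apply: eq_map => i.
  by rewrite (tnth_nth 0) /= nth_iota.
by exists pi; rewrite // mem_enum avE -eq_w.
Qed.

(** * Recurrences and initial values *)

Lemma size_words0 (P : pred (seq nat)) : P [::] -> size (words P 0) = 1.
Proof. by move=> P0; rewrite /words /= P0. Qed.

Lemma size_av213T_rec n :
  size (words av213T n.+1) =
  size (words av213T n) + \sum_(i < n) size (words av213T i.+1).
Proof.
rewrite size_words_head big_ord_recl (size_words_head0 _ av213T_shift).
congr (_ + _); apply: eq_bigr => i _.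
rewrite -[RHS](size_words_head_av213T (n - i.+1)) //.
by rewrite subnKC.
Qed.

(** The first letters 0 and [n.+1] each leave an arbitrary avoider; the first letter [i.+1] has
    [n - i] letters above it. *)
Lemma size_avT_rec n :
  size (words avT n.+2) = 2 * size (words avT n.+1) +
  \sum_(i < n) (size (words avT i.+2) + (n - i).-1 * size (words av213T i.+1)).
Proof.
rewrite size_words_head big_ord_recl (size_words_head0 _ avT_shift).
rewrite big_ord_recr /= (size_words_head_max n.+1) addnCA addnC.
rewrite mul2n -addnn; congr (_ + _).
apply: eq_bigr => i _.
rewrite -size_words_head_avT // ?subn_gt0 // addSn subnKC //.
exact: ltnW.
Qed.

Lemma size_av213T_rec2 n :
  size (words av213T n.+2) + size (words av213T n) =
  3 * size (words av213T n.+1).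
Proof.
have := size_av213T_rec n; have := size_av213T_rec n.+1.
by rewrite big_ord_recr /=; lia.
Qed.

Lemma size_avT_rec2 n :
  size (words avT n.+3) + 2 * size (words avT n.+1) + size (words av213T n) =
  4 * size (words avT n.+2) + size (words av213T n.+1).
Proof.
have := size_avT_rec n; have := size_av213T_rec n.
have := size_avT_rec n.+1; rewrite big_ord_recr /= subSnn mul0n addn0.
(* From [n] to [n.+1] every factor grows by one, which adds the sum of the b_(i+1), equal to b_(n+1)
   - b_n. *)
rewrite (eq_bigr (fun i : 'I_n => size (words avT i.+2) +
  (n - i).-1 * size (words av213T i.+1) + size (words av213T i.+1))) => [|i _].
  rewrite big_split /=; lia.
rewrite subSn; last exact: ltnW.
by rewrite /= -addnA -mulSnr prednK // subn_gt0.
Qed.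

(** Combining three consecutive instances of [size_avT_rec2] with coefficients 1, -3, 1 eliminates
    b; the result has the coefficients of the product of 1 - 3x + x^2 and 1 - 4x + 2x^2. *)
Lemma size_avT_rec4 n :
  size (words avT n.+4.+1) + 15 * size (words avT n.+3) +
  2 * size (words avT n.+1) =
  7 * size (words avT n.+4) + 10 * size (words avT n.+2).
Proof.
have := size_avT_rec2 n; have := size_avT_rec2 n.+1; have := size_avT_rec2 n.+2.
have := size_av213T_rec2 n; have := size_av213T_rec2 n.+1; lia.
Qed.

(** [size_avT_rec4] first determines the value at 5, so five initial values are needed; the shorter
    recurrences yield them without enumeration. *)
Lemma size_avT_small :
  [seq size (words avT n) | n <- iota 0 5] = [:: 1; 1; 2; 6; 21].
Proof.
have a0 : size (words avT 0) = 1.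
  by apply: size_words0; apply/avTP => a b c d; rewrite subseq0.
have b0 : size (words av213T 0) = 1.
  by apply: size_words0; apply/andP; split; [apply/av213P | apply/avTP].
have b1 := size_av213T_rec 0; have b2 := size_av213T_rec2 0.
have a1 := size_words_head avT 0; have a2 := size_avT_rec 0.
have a3 := size_avT_rec2 0; have a4 := size_avT_rec2 1.
rewrite big_ord0 in b1; rewrite big_ord0 in a2.
rewrite big_ord_recl big_ord0 (size_words_head_max 0) in a1.
rewrite /=; congr [:: _; _; _; _; _]; lia.
Qed.

(** * Power series and the generating function *)

Local Open Scope ring_scope.

(** Coefficients up to [n] of a product involve only those up to [n] of the factors, so
    associativity carries over from polynomials. *)
Lemma coef_mul_truncated (R : nzRingType) (f g : fps R) m n : (m <= n)%N ->
  ((\poly_(i < n.+1) f i) * (\poly_(i < n.+1) g i))`_m = fps_mul f g m.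
Proof.
move=> le_mn; rewrite coefM; apply: eq_bigr => i _; rewrite !coef_poly.
by rewrite !ltnS (leq_trans (leq_ord i)) // (leq_trans (leq_subr _ _)).
Qed.

Lemma fps_mulA (R : nzRingType) (f g h : fps R) :
  fps_mul f (fps_mul g h) =1 fps_mul (fps_mul f g) h.
Proof.
move=> n; pose tr (e : fps R) := \poly_(i < n.+1) e i.
transitivity ((tr f * (tr g * tr h))`_n).
  rewrite coefM; apply: eq_bigr => i _; rewrite coef_poly ltn_ord.
  by rewrite coef_mul_truncated // leq_subr.
rewrite mulrA coefM; apply: eq_bigr => i _; rewrite [(tr h)`_ _]coef_poly.
by rewrite ltnS leq_subr coef_mul_truncated // -ltnS.
Qed.

(** Associativity turns f q = p into f = f (q q^-1) = p q^-1. *)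
Lemma eq_fps_div (R : fieldType) (f p q : fps R) :
  q 0%N != 0 -> fps_mul f q =1 p -> f =1 fps_div p q.
Proof.
move=> q0 fq n; transitivity (fps_mul f (fps_of_poly 1) n).
  rewrite /fps_mul big_ord_recr /= subnn /fps_of_poly coef1 mulr1.
  rewrite big1 ?add0r //.
  by move=> i _; rewrite coef1 subn_eq0 leqNgt ltn_ord mulr0.
transitivity (fps_mul f (fps_mul q (fps_inv q)) n).
  by apply: eq_bigr => i _; rewrite fps_mulfV.
by rewrite fps_mulA; apply: eq_bigr => i _; rewrite fq.
Qed.

Lemma denominatorE :
  (1 - 3 *: 'X + 'X^2) * (1 - 4 *: 'X + 2 *: 'X^2) =
  Poly [:: 1; - 7%:R; 15%:R; - 10%:R; 2%:R] :> {poly rat}.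
Proof.
rewrite /= !cons_poly_def -!mul_polyC; ring.
Qed.

Lemma numeratorE :
  1 - 6 *: 'X + 10 *: 'X^2 - 3 *: 'X^3 + 'X^4 =
  Poly [:: 1; - 6%:R; 10%:R; - 3%:R; 1] :> {poly rat}.
Proof.
rewrite /= !cons_poly_def -!mul_polyC; ring.
Qed.

Theorem theorem18 :
  avoiders_gf [:: [:: 2; 1; 3; 4]%N; [:: 2; 3; 4; 1]%N; [:: 2; 4; 1; 3]%N]
  =1 fps_div
       (fps_of_poly
          (1 - 6 *: 'X + 10 *: 'X^2 - 3 *: 'X^3 + 'X^4 : {poly rat}))
       (fps_of_poly
          ((1 - 3 *: 'X + 'X^2) * (1 - 4 *: 'X + 2 *: 'X^2) : {poly rat})).
Proof.
rewrite denominatorE numeratorE.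
apply: eq_fps_div => [|n]; first by rewrite /fps_of_poly coef_Poly.
pose a n : rat := (size (words avT n))%:R.
have gfE m : avoiders_gf T m = a m by rewrite /avoiders_gf card_avoiders.
rewrite /fps_mul; under eq_bigr do rewrite gfE /fps_of_poly coef_Poly.
(* Reversing the sum gives index [i] to the coefficients of the denominator, so that only [i < 5]
   contributes. *)
rewrite (reindex_inj rev_ord_inj) /fps_of_poly coef_Poly /=.
under eq_bigr => i _ do rewrite subSS subKn -1?ltnS //.
(* The numerator has degree 4: below 5 its coefficients come from the initial values, and from 5 on
   the convolution vanishes by [size_avT_rec4]. *)
have [n_lt5 | n_ge5] := ltnP n 5.
  have : [seq a n | n <- iota 0 5] = [seq m%:R | m <- [:: 1; 1; 2; 6; 21]%N].
    by rewrite -size_avT_small -map_comp.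
  rewrite /= => -[a0 a1 a2 a3 a4].
  by case: n n_lt5 => [|[|[|[|[|n]]]]] // _; rewrite !big_ord_recl big_ord0 /=
    /bump /= ?(a0, a1, a2, a3, a4).
rewrite -(subnKC n_ge5); move: (n - 5)%N => {n n_ge5} n.
rewrite 5!big_ord_recl big1 => [|i _]; last by rewrite /= nth_default ?mulr0.
have : a n.+4.+1 + 15%:R * a n.+3 + 2%:R * a n.+1 =
         7%:R * a n.+4 + 10%:R * a n.+2.
  by rewrite -!natrM -!natrD size_avT_rec4.
rewrite /= [nth _ _ _]nth_default // /bump /= !subSS !subn0.
by rewrite -[(5 + n)%N]/n.+4.+1; move: (a n.+4.+1) (a n.+4) (a n.+3) => *; lra.
Qed.
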